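(* For every finite nonempty set $S\subset\mathbb{R}^2$ of points in general position there exists a triangulation $T$ of $S$ that is $\frac{2\pi}{3}$-open. Moreover, this bound is best possible: for every $\varepsilon>0$ there exists a finite set $S\subset\mathbb{R}^2$ of points in general position such that every triangulation $T$ of $S$ satisfies $\mathrm{op}(T)<\frac{2\pi}{3}+\varepsilon$.
   Context: A finite set $S\subset\mathbb{R}^2$ is in general position if no three of its points are collinear. A plane straight-line graph $G=(S,E)$ on $S$ has vertex set $S$, its edges are straight-line segments connecting two points of $S$, and two edges do not intersect except possibly at common endpoints. A triangulation of $S$ is an edge-maximal plane straight-line graph on $S$ (equivalently, for $|S|\ge 3$, it contains all edges of the convex hull of $S$ and every bounded face is a triangle). The incident angles of $p\in S$ in $G$ are the angles between two edges of $G$ that appear consecutively in the circular order of the edges incident to $p$ (so for a vertex of degree at least two they sum to $2\pi$). The openness $\mathrm{op}_G(p)$ of $p$ in $G$ is the maximum incident angle of $p$ in $G$; if $p$ has degree at most one, set $\mathrm{op}_G(p)=2\pi$. The openness of $G$ is $\mathrm{op}(G)=\min_{p\in S}\mathrm{op}_G(p)$, and $G$ is called $\varphi$-open if $\mathrm{op}(G)\ge\varphi$. *)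

(* Defs.v *)
From HB Require Import structures.
From mathcomp Require Import all_boot all_order all_algebra finmap.
From mathcomp Require Import reals trigo.

Set Implicit Arguments.
Unset Strict Implicit.
Unset Printing Implicit Defensive.

Import Order.TTheory GRing.Theory Num.Theory.
Local Open Scope fset_scope.
Local Open Scope ring_scope.

(* The plane is [R * R] for an arbitrary [R : realType]. *)

Section Plane.
Context {R : realType}.
Local Notation point := (R * R)%type.

Implicit Types (p q r s x u v : point) (S : {fset point}).

Definition collinear p q r : Prop :=
  exists a b c : R, (a, b) != (0, 0) /\
    [/\ a * p.1 + b * p.2 = c, a * q.1 + b * q.2 = c & a * r.1 + b * r.2 = c].

Definition general_position S : Prop :=
  forall p q r, p \in S -> q \in S -> r \in S ->
    p != q -> p != r -> q != r -> ~ collinear p q r.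

Definition on_segment p q x : Prop :=
  exists t : R, 0 <= t <= 1 /\
    x = ((1 - t) * p.1 + t * q.1, (1 - t) * p.2 + t * q.2).

(* The edge with endpoints p and q is encoded by the set [fset p; q]; since
   edges are required to have exactly two elements, there are no loops. *)
Definition plane_graph S (E : {fset {fset point}}) : Prop :=
  (forall e, e \in E -> #|` e| = 2%N /\ e `<=` S) /\
  (forall p q r s x, [fset p; q] \in E -> [fset r; s] \in E ->
     [fset p; q] != [fset r; s] -> on_segment p q x -> on_segment r s x ->
     x \in [fset p; q] /\ x \in [fset r; s]).

Definition triangulation S (E : {fset {fset point}}) : Prop :=
  plane_graph S E /\
  forall E' : {fset {fset point}}, plane_graph S E' -> E `<=` E' -> E' = E.

Definition dotp u v : R := u.1 * v.1 + u.2 * v.2.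
Definition crossp u v : R := u.1 * v.2 - u.2 * v.1.
Definition enorm u : R := Num.sqrt (dotp u u).

(* The counterclockwise angle, in [0, 2 pi), from the nonzero vector u to the
   nonzero vector v: [acos] only yields the unoriented angle in [0, pi], and
   the sign of the cross product tells on which side of u the vector v lies. *)
Definition ccw_angle u v : R :=
  let a := acos (dotp u v / (enorm u * enorm v)) in
  if 0 <= crossp u v then a else 2 * pi - a.

(* The angle at p swept counterclockwise from the edge pq to the edge pr. *)
Definition angle_at p q r : R :=
  ccw_angle (q.1 - p.1, q.2 - p.2) (r.1 - p.1, r.2 - p.2).

Definition neighbours S (E : {fset {fset point}}) p : {fset point} :=
  [fset q in S | [fset p; q] \in E].

(* The edge pr is the immediate counterclockwise successor of pq around p. At a
   vertex of degree two, both (q, r) and (r, q) are consecutive, and they give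
   two incident angles with sum 2 pi. *)
Definition consecutive S (E : {fset {fset point}}) p q r : bool :=
  let N := neighbours S E p in
  [&& q \in N, r \in N, q != r &
      all (fun s => (s != q) ==> (angle_at p q r <= angle_at p q s)) N].

(* The neutral elements 0 and 2 pi of the maximum and the minimum below never
   matter: incident angles lie in (0, 2 pi), a vertex of degree at least two
   has one, and [openness] is only used for nonempty S. *)
Definition vertex_openness S (E : {fset {fset point}}) p : R :=
  let N := neighbours S E p in
  if (#|` N| <= 1)%N then 2 * pi
  else \big[Num.max/0]_(q <- N)
         \big[Num.max/0]_(r <- N | consecutive S E p q r) angle_at p q r.

Definition openness S (E : {fset {fset point}}) : R :=
  \big[Num.min/(2 * pi)]_(p <- S) vertex_openness S E p.

Definition phi_open S (E : {fset {fset point}}) (phi : R) : Prop :=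
  phi <= openness S E.

End Plane.

(* Main.v *)
(** Call a point [p] settled if it is a vertex of an empty triangle [p b c] all
    of whose sides are edges and whose angle at [p] is at least 120 degrees. No
    edge can be added to a plane graph inside that angle at [p], so [p] stays
    settled in every maximal plane extension, and it suffices to build a plane
    graph in which every point other than the hull vertices is settled; a hull
    vertex always has an incident angle of at least 180 degrees.

    Inside a triangle [a b c], every interior point sees some side under an angle
    of at least 120 degrees. If this side is [b c], choose among the interior
    points that see [b c] under such an angle one closest to [b c]; call it [p].
    The triangle [p b c] is empty, so [p] becomes settled when it is joined to
    [a], [b], [c], and one recurses into [a b p] and [a p c].

    The triangle construction is applied to the triangles spanned by a fixed hull
    vertex and the hull edges not incident to it; these triangles cover the
    convex hull of the point set.

    The bound is attained by the vertices of an equilateral triangle with its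
    center: the complete graph on these four points is plane, so it is the only
    triangulation, and the three angles at the center are equal. *)

Require Import Defs.
From HB Require Import structures.
From mathcomp Require Import all_boot all_order all_algebra finmap.
From mathcomp Require Import ring lra zify.
From mathcomp Require Import boolp reals trigo.

Set Implicit Arguments.
Unset Strict Implicit.
Unset Printing Implicit Defensive.

Import Order.TTheory GRing.Theory Num.Theory.
Local Open Scope fset_scope.
Local Open Scope ring_scope.

(** * Orientation and segments *)

Section Orientation.
Context {R : realType}.
Local Notation point := (R * R)%type.
Implicit Types (a b c p q r s u v w x : point) (S : {fset point}).

(** Twice the signed area of the triangle [p q r], positive when it is counterclockwise. *)
Definition orient p q r : R :=
  (q.1 - p.1) * (r.2 - p.2) - (q.2 - p.2) * (r.1 - p.1).

Definition dot_at p q r : R :=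
  (q.1 - p.1) * (r.1 - p.1) + (q.2 - p.2) * (r.2 - p.2).

(** The interior of a counterclockwise triangle; by [orient_sum], no point satisfies this for a
    clockwise or degenerate one. *)
Definition in_tri a b c x : bool :=
  [&& 0 < orient a b x, 0 < orient b c x & 0 < orient c a x].

Definition in_ctri a b c x : bool :=
  [&& 0 <= orient a b x, 0 <= orient b c x & 0 <= orient c a x].

(* The angle from [b] to [c] at [p] is between [2 pi / 3] and [pi]: its cotangent
   is at most [- 1 / sqrt 3]. *)
Definition wide p b c : bool :=
  (0 < orient p b c) && (Num.sqrt 3 * dot_at p b c + orient p b c <= 0).

Lemma orient_rot p q r : orient p q r = orient q r p.
Proof. rewrite /orient; ring. Qed.

Lemma orient_swap p q r : orient p q r = - orient q p r.
Proof. rewrite /orient; ring. Qed.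

Lemma orient_swapr p q r : orient p q r = - orient p r q.
Proof. rewrite /orient; ring. Qed.

Lemma orientpp p q : orient p p q = 0.
Proof. rewrite /orient; ring. Qed.

Lemma orientpqp p q : orient p q p = 0.
Proof. rewrite /orient; ring. Qed.

Lemma orientpqq p q : orient p q q = 0.
Proof. rewrite /orient; ring. Qed.

Lemma orient_sum a b c x :
  orient a b x + orient b c x + orient c a x = orient a b c.
Proof. rewrite /orient; ring. Qed.

(** The areas [orient b c x], [orient c a x], [orient a b x] are unnormalised barycentric
    coordinates of [x], and [orient p q] is affine in its last argument. *)
Lemma orient_bary a b c p q x :
  orient a b c * orient p q x = orient b c x * orient p q a +
    orient c a x * orient p q b + orient a b x * orient p q c.
Proof. rewrite /orient; ring. Qed.

Lemma in_tri_rot a b c x : in_tri a b c x = in_tri b c a x.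
Proof. by rewrite /in_tri [LHS]andbC -andbA. Qed.

Lemma in_ctri_rot a b c x : in_ctri a b c x = in_ctri b c a x.
Proof. by rewrite /in_ctri [LHS]andbC -andbA. Qed.

Lemma in_triW a b c x : in_tri a b c x -> in_ctri a b c x.
Proof. by case/and3P=> h1 h2 h3; rewrite /in_ctri !ltW. Qed.

Lemma orient_neq p q r : orient p q r != 0 -> [/\ p != q, p != r & q != r].
Proof.
by move=> h; split; apply: contraNneq h => ->;
  rewrite ?orientpp ?orientpqp ?orientpqq.
Qed.

Lemma collinear_orient p q r : collinear p q r -> orient p q r = 0.
Proof.
case=> a [b] [c] [ab0 [hp hq hr]].
have ha : a * orient p q r = 0.
  have -> : a * orient p q r =
    ((a * q.1 + b * q.2) - (a * p.1 + b * p.2)) * (r.2 - p.2)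
    - ((a * r.1 + b * r.2) - (a * p.1 + b * p.2)) * (q.2 - p.2).
    by rewrite /orient; ring.
  by rewrite hp hq hr; ring.
have hb : b * orient p q r = 0.
  have -> : b * orient p q r =
    ((a * r.1 + b * r.2) - (a * p.1 + b * p.2)) * (q.1 - p.1)
    - ((a * q.1 + b * q.2) - (a * p.1 + b * p.2)) * (r.1 - p.1).
    by rewrite /orient; ring.
  by rewrite hp hq hr; ring.
apply/eqP; move: ab0; apply: contraNT => h0.
move/eqP: ha; move/eqP: hb; rewrite !mulf_eq0 (negbTE h0) !orbF.
by move=> /eqP -> /eqP ->.
Qed.

Lemma orient_collinear p q r : p != q -> orient p q r = 0 -> collinear p q r.
Proof.
move=> pq h0; exists (p.2 - q.2), (q.1 - p.1), (p.2 * q.1 - p.1 * q.2).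
split; last first.
  split; [ring|ring|].
  apply/eqP; rewrite -subr_eq0 -h0 /orient; apply/eqP; ring.
apply: contraNneq pq => -[] h1 h2.
rewrite [p]surjective_pairing [q]surjective_pairing; apply/eqP; congr pair; lra.
Qed.

Lemma gp_orient S : general_position S <->
  forall p q r, p \in S -> q \in S -> r \in S ->
    p != q -> p != r -> q != r -> orient p q r != 0.
Proof.
split=> gp p q r pS qS rS pq pr qr.
  by apply/eqP => h0; apply: (gp p q r) => //; apply: orient_collinear.
by move=> /collinear_orient/eqP; apply/negP; apply: gp.
Qed.

Lemma on_segment_orient p q x : on_segment p q x ->
  exists2 t, 0 <= t <= 1 &
    forall u v, orient u v x = (1 - t) * orient u v p + t * orient u v q.
Proof.
by case=> t [ht ->]; exists t => // u v; rewrite /orient /=; ring.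
Qed.

Lemma on_segment_sym p q x : on_segment p q x -> on_segment q p x.
Proof.
case=> t [/andP[t0 t1] ->]; exists (1 - t); split; first lra.
by congr pair; ring.
Qed.

Lemma on_segmentl p q : on_segment p q p.
Proof. by exists 0; split; [lra|rewrite [LHS]surjective_pairing; congr pair; ring]. Qed.

(** The barycentric weight of [c] vanishes, so [x] is a convex combination of [a] and [b], with the
    normalised weight of [b] as parameter. *)
Lemma in_ctri_edge a b c x : 0 < orient a b c -> in_ctri a b c x ->
  orient a b x = 0 -> on_segment a b x.
Proof.
move=> D0 /and3P[_ hb hc] ha; exists (orient c a x / orient a b c).
have hs := orient_sum a b c x.
split.
  rewrite divr_ge0 ?(ltW D0) //= ler_pdivrMr // mul1r -hs ha; lra.
have Dn : orient a b c != 0 by rewrite gt_eqF.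
have -> : 1 - orient c a x / orient a b c = orient b c x / orient a b c.
  by rewrite -{1}(divff Dn) -{1}hs ha; field.
rewrite [LHS]surjective_pairing; congr pair; apply: (mulfI Dn).
  have -> : orient a b c * x.1 = orient b c x * a.1 + orient c a x * b.1 +
      orient a b x * c.1 by rewrite /orient; ring.
  by rewrite ha; field.
have -> : orient a b c * x.2 = orient b c x * a.2 + orient c a x * b.2 +
      orient a b x * c.2 by rewrite /orient; ring.
by rewrite ha; field.
Qed.

Lemma on_segment_ctri a b c p q x : in_ctri a b c p -> in_ctri a b c q ->
  on_segment p q x -> in_ctri a b c x.
Proof.
case/and3P=> p1 p2 p3 /and3P[q1 q2 q3] /on_segment_orient[t /andP[t0 t1] ht].
by apply/and3P; split; rewrite ht addr_ge0 // mulr_ge0 // subr_ge0.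
Qed.

Lemma on_segment_share p q r x : orient p q r != 0 ->
  on_segment p q x -> on_segment p r x -> x = p.
Proof.
move=> h0 /on_segment_orient[t _ ht] [u [_ Ex]].
have : u * orient p q r = 0.
  have <- : orient p q x = u * orient p q r by rewrite Ex /orient /=; ring.
  by rewrite ht orientpqp orientpqq; ring.
move/eqP; rewrite mulf_eq0 (negbTE h0) orbF => /eqP u0.
by rewrite Ex u0 [RHS]surjective_pairing; congr pair; ring.
Qed.

(** Convexity: by [orient_bary], each side functional of [a b c] is at [x] a nonnegative combination
    of its values at [a'], [b'], [c']. *)
Lemma in_tri_ctri_sub a b c a' b' c' x : 0 < orient a' b' c' ->
  in_ctri a b c a' -> in_ctri a b c b' -> in_ctri a b c c' ->
  in_ctri a' b' c' x -> in_ctri a b c x.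
Proof.
move=> D0 /and3P[a1 a2 a3] /and3P[b1 b2 b3] /and3P[c1 c2 c3] /and3P[x1 x2 x3].
apply/and3P; split; rewrite -(pmulr_rge0 _ D0) orient_bary;
  by apply: addr_ge0; [apply: addr_ge0|]; apply: mulr_ge0.
Qed.

Lemma in_ctri_verts a b c : 0 < orient a b c ->
  [/\ in_ctri a b c a, in_ctri a b c b & in_ctri a b c c].
Proof.
move=> D0; split; rewrite /in_ctri ?orientpqp ?orientpqq ?lexx /= ?andbT.
- by rewrite -orient_rot ltW.
- by rewrite orient_rot ltW.
- by rewrite ltW.
Qed.

End Orientation.

(** * Angles of at least 120 degrees *)

Section Wide.
Context {R : realType}.
Local Notation point := (R * R)%type.
Implicit Types (a b c p q r s u v w x : point).

Let k : R := Num.sqrt 3.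

Let k_gt0 : 0 < k. Proof. by rewrite sqrtr_gt0; lra. Qed.

Let k2 : k ^+ 2 = 3. Proof. by rewrite sqr_sqrtr //; lra. Qed.

(* The cotangents of three angles with sum [2 pi] satisfy
   [X Y + Y Z + Z X = 1]; this is the claim that they cannot all exceed
   [- 1 / sqrt 3] (stated for the cotangents scaled by [sqrt 3]). *)
Lemma cot_bound (X Y Z : R) : -1 < X -> -1 < Y -> -1 < Z ->
  X + Y <= 0 -> Y + Z <= 0 -> Z + X <= 0 -> X * Y + Y * Z + Z * X = 3 -> False.
Proof.
move=> X1 Y1 Z1 XY YZ ZX E.
(* If one number is positive, the other two lie in [(-1, 0)]: their product is below 1 and the mixed
   products are negative. If none is positive, each product is below 1. *)
case: (ltrP 0 X) => hX; first by nra.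
case: (ltrP 0 Y) => hY; first by nra.
case: (ltrP 0 Z) => hZ; first by nra.
nra.
Qed.

Lemma wide_exists a b c p : in_tri a b c p ->
  [|| wide p b c, wide p c a | wide p a b].
Proof.
case/and3P; rewrite -!(orient_rot p) => C0 A0 B0.
rewrite /wide C0 A0 B0 /=; apply/negPn/negP; rewrite !negb_or -!ltNge.
case/and3P=> hA hB hC.
set A := orient p b c in A0 hA; set B := orient p c a in B0 hB.
set C := orient p a b in C0 hC; set Y := dot_at p b c in hA.
set Z := dot_at p c a in hB; set X := dot_at p a b in hC.
(* The identity for the cotangents [X / C], [Y / A], [Z / B], with denominators cleared. *)
have E : X * Y * B + Y * Z * C + Z * X * A = A * B * C.
  by rewrite /A /B /C /X /Y /Z /orient /dot_at; ring.
have norm_ge0 u v : 0 <= (u.1 - v.1) ^+ 2 + (u.2 - v.2) ^+ 2 :> R.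
  by rewrite addr_ge0 // sqr_ge0.
(* Any two of the angles at [p] have sum at least [pi], since the third is below [pi]; hence their
   cotangents have nonpositive sum. *)
have EXZ : B * X + C * Z <= 0.
  have -> : B * X + C * Z = - (A * ((a.1 - p.1) ^+ 2 + (a.2 - p.2) ^+ 2)).
    by rewrite /A /B /C /X /Z /orient /dot_at; ring.
  by rewrite oppr_le0 mulr_ge0 // ltW.
have EXY : A * X + C * Y <= 0.
  have -> : A * X + C * Y = - (B * ((b.1 - p.1) ^+ 2 + (b.2 - p.2) ^+ 2)).
    by rewrite /A /B /C /X /Y /orient /dot_at; ring.
  by rewrite oppr_le0 mulr_ge0 // ltW.
have EYZ : B * Y + A * Z <= 0.
  have -> : B * Y + A * Z = - (C * ((c.1 - p.1) ^+ 2 + (c.2 - p.2) ^+ 2)).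
    by rewrite /A /B /C /Y /Z /orient /dot_at; ring.
  by rewrite oppr_le0 mulr_ge0 // ltW.
have An : A != 0 by rewrite gt_eqF.
have Bn : B != 0 by rewrite gt_eqF.
have Cn : C != 0 by rewrite gt_eqF.
apply: (@cot_bound (k * X / C) (k * Y / A) (k * Z / B)).
- by rewrite ltr_pdivlMr // /k; lra.
- by rewrite ltr_pdivlMr // /k; lra.
- by rewrite ltr_pdivlMr // /k; lra.
- have -> : k * X / C + k * Y / A = k * (A * X + C * Y) / (A * C).
    by field; rewrite An Cn.
  by rewrite ler_pdivrMr ?mulr_gt0 // mul0r pmulr_rle0.
- have -> : k * Y / A + k * Z / B = k * (B * Y + A * Z) / (A * B).
    by field; rewrite An Bn.
  by rewrite ler_pdivrMr ?mulr_gt0 // mul0r pmulr_rle0.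
- have -> : k * Z / B + k * X / C = k * (B * X + C * Z) / (B * C).
    by field; rewrite Bn Cn.
  by rewrite ler_pdivrMr ?mulr_gt0 // mul0r pmulr_rle0.
have -> : k * X / C * (k * Y / A) + k * Y / A * (k * Z / B) +
    k * Z / B * (k * X / C) =
    k ^+ 2 * (X * Y * B + Y * Z * C + Z * X * A) / (A * B * C).
  by field; rewrite An Bn Cn.
by rewrite k2 E; field; rewrite An Bn Cn.
Qed.

(* The points seeing [bc] under an angle at least [2 pi / 3] form a circular
   segment, hence a convex set. *)
Lemma wide_inner p b c q : wide p b c -> in_tri p b c q -> wide q b c.
Proof.
case/andP=> D0 hp /and3P[y0 x0 z0].
apply/andP; split; first by rewrite orient_rot.
set D := orient p b c in D0 hp; set x := orient b c q in x0.
set y := orient c p q in z0; set z := orient p b q in y0.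
have norm_ge0 u v : 0 <= (u.1 - v.1) ^+ 2 + (u.2 - v.2) ^+ 2 :> R.
  by rewrite addr_ge0 // sqr_ge0.
(* The function [k * dot_at q b c + orient q b c] of [q] is quadratic with leading part [k * |q|^2]
   and vanishes at [b] and [c]. At a convex combination it equals the weighted mean of its values at
   [p], [b], [c] minus [k] times the weighted squared side lengths. *)
have E : D ^+ 2 * (k * dot_at q b c + orient q b c) =
    x * D * (k * dot_at p b c + D) - k *
   (x * y * ((p.1 - b.1) ^+ 2 + (p.2 - b.2) ^+ 2) +
    x * z * ((p.1 - c.1) ^+ 2 + (p.2 - c.2) ^+ 2) +
    y * z * ((b.1 - c.1) ^+ 2 + (b.2 - c.2) ^+ 2)).
  by rewrite /D /x /y /z /orient /dot_at; ring.
rewrite -(@pmulr_rle0 _ (D ^+ 2)) ?exprn_gt0 // E subr_le0.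
apply: (@le_trans _ _ 0).
  by rewrite pmulr_rle0 // mulr_gt0.
by apply: mulr_ge0; [exact: ltW|apply: addr_ge0; [apply: addr_ge0|]];
  rewrite mulr_ge0 // mulr_ge0 // ltW.
Qed.

(** Turning on from [c] to [s], still within a half-turn of [b], enlarges the angle at [p], and the
    cotangent decreases on [(0, pi)]. *)
Lemma wide_beyond p b c s : wide p b c -> 0 < orient p b s ->
  0 < orient p c s -> k * dot_at p b s + orient p b s <= 0.
Proof.
case/andP=> D0 hc bs cs; rewrite -(pmulr_rle0 _ D0).
have -> : orient p b c * (k * dot_at p b s + orient p b s) =
    orient p b s * (k * dot_at p b c + orient p b c) -
    orient p c s * (k * ((b.1 - p.1) ^+ 2 + (b.2 - p.2) ^+ 2)).
  by rewrite /orient /dot_at; ring.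
rewrite subr_le0; apply: (@le_trans _ _ 0); first by rewrite pmulr_rle0.
by apply: mulr_ge0; [exact: ltW|apply: mulr_ge0; [exact: ltW|]];
  rewrite addr_ge0 // sqr_ge0.
Qed.

(** A polynomial criterion for a counterclockwise angle of at least 120 degrees; negative
    orientation means an angle beyond [pi]. *)
Definition wide_or_reflex p q s : bool :=
  (orient p q s < 0) || (k * dot_at p q s + orient p q s <= 0).

Lemma cos_2pi3 : cos (2 * pi / 3 : R) = - (1 / 2).
Proof.
have pi0 := pi_gt0 R.
set y : R := pi / 3.
have -> : 2 * pi / 3 = - y + pi by rewrite /y; field.
rewrite cosDpi cosN; congr (- _).
have y0 : 0 < cos y by apply: cos_gt0_pihalf; rewrite /y; lra.
have : cos (y + y + y) = -1 by rewrite -cospi; congr cos; rewrite /y; field.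
rewrite !cosD sinD.
have := cos2Dsin2 y; move: (cos y) (sin y) y0 => c s c0 cs h.
(* The triple-angle formula gives [4 c^3 - 3 c + 1 = 0], which factors like this; [c0] excludes the
   root [-1]. *)
have : (c + 1) * (2 * c - 1) ^+ 2 = 0.
  transitivity (1 + (c * c - s * s) * c - (s * c + c * s) * s +
    3 * c * (c ^+ 2 + s ^+ 2 - 1)); first ring.
  by rewrite cs; lra.
by move/eqP; rewrite mulf_eq0 sqrf_eq0 => /orP[] /eqP ?; lra.
Qed.

Lemma le_2pi3_angle_at p q s : orient p q s != 0 -> wide_or_reflex p q s ->
  2 * pi / 3 <= angle_at p q s.
Proof.
have pi0 := pi_gt0 R.
rewrite /angle_at /ccw_angle.
set u := (_ - _, _); set v := (_ - _, _).
rewrite /wide_or_reflex -/(crossp u v) -/(dotp u v).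
rewrite -[orient p q s]/(crossp u v) -[dot_at p q s]/(dotp u v).
set c := crossp u v; set d := dotp u v; set N := enorm u * enorm v.
have N0 : 0 <= N by rewrite mulr_ge0 // sqrtr_ge0.
have N2 : N ^+ 2 = d ^+ 2 + c ^+ 2.
  rewrite /N /enorm exprMn !sqr_sqrtr; first by rewrite /c /d /dotp /crossp; ring.
    by rewrite addr_ge0 // -expr2 sqr_ge0.
  by rewrite addr_ge0 // -expr2 sqr_ge0.
move=> cn hc.
have {}N0 : 0 < N.
  rewrite lt_def N0 andbT; apply: contra_neq cn => N00.
  by move: N2; rewrite N00 => ?; nra.
have x1 : -1 <= d / N <= 1.
  by rewrite ler_pdivlMr // ler_pdivrMr //; apply/andP; split; nra.
have [c0|c0] := leP 0 c; last by have := acos_lepi x1; lra.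
move: hc; rewrite ltNge c0 /= => hc.
have k0 := k_gt0; have k3 := k2.
(* From [k * d + c <= 0 <= c] follow [d <= 0] and [c^2 <= 3 d^2], so [N^2 <= 4 d^2]. *)
have xh : d / N <= - (1 / 2).
  have d0 : d <= 0 by rewrite -(pmulr_rle0 _ k0); lra.
  have cd : c ^+ 2 <= 3 * d ^+ 2 by rewrite -k3; nra.
  by rewrite ler_pdivrMr //; nra.
rewrite leNgt; apply/negP => hlt.
have : cos (2 * pi / 3 : R) < cos (acos (d / N)).
  rewrite ltr_cos // in_itv /=; last by lra.
  by rewrite acos_ge0 // acos_lepi.
by rewrite cos_2pi3 acosK //; lra.
Qed.

Lemma angle_at_eq_2pi3 p q s : 0 < orient p q s -> dot_at p q q = 4 ->
  dot_at p s s = 4 -> dot_at p q s = -2 -> angle_at p q s = 2 * pi / 3.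
Proof.
have pi0 := pi_gt0 R.
rewrite /angle_at /ccw_angle.
set u := (_ - _, _); set v := (_ - _, _).
rewrite -[orient p q s]/(crossp u v) -[dot_at p q s]/(dotp u v).
rewrite -[dot_at p q q]/(dotp u u) -[dot_at p s s]/(dotp v v).
move=> /ltW -> uu vv ->; rewrite /enorm uu vv.
rewrite -expr2 sqr_sqrtr //.
have -> : -2 / 4 = - (1 / 2) :> R by field.
by rewrite -cos_2pi3 cosK // in_itv /=; lra.
Qed.

End Wide.

(** * Plane graphs inside a triangle *)

Section PlaneGraphs.
Context {R : realType}.
Local Notation point := (R * R)%type.
Implicit Types (a b c p q r s u v w x : point) (S e f : {fset point}).
Implicit Types (E F : {fset {fset point}}).

Definition on_edge e x : Prop := exists p q, e = [fset p; q] /\ on_segment p q x.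

(** Relating two edge sets allows the planarity of a union to be checked piece by piece. *)
Definition noncrossing E1 E2 : Prop := forall e1 e2 x, e1 \in E1 -> e2 \in E2 ->
  e1 != e2 -> on_edge e1 x -> on_edge e2 x -> x \in e1 /\ x \in e2.

Lemma fset2_eq p q u v : [fset p; q] = [fset u; v] ->
  (p = u /\ q = v) \/ (p = v /\ q = u).
Proof.
move/fsetP=> h; have := (h p, h q, h u, h v); rewrite !inE !eqxx !orbT /=.
case=> [[[/esym/orP hp /esym/orP hq] /orP hu] /orP hv].
case: hp hq hu hv => /eqP -> [] /eqP -> [] /eqP hu [] /eqP hv; subst; auto.
Qed.

Lemma on_edge2 p q x : on_edge [fset p; q] x <-> on_segment p q x.
Proof.
split=> [[u [v [/fset2_eq[] [-> ->]]]]//|h]; last by exists p, q.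
exact: on_segment_sym.
Qed.

Lemma plane_graphE S E : plane_graph S E <->
  (forall e, e \in E -> #|` e| = 2%N /\ e `<=` S) /\ noncrossing E E.
Proof.
split=> -[hE pl]; split=> //.
  move=> e1 e2 x h1 h2 ne [p [q [e1E hp]]] [r [s [e2E hr]]].
  by subst; apply: (pl p q r s x).
move=> p q r s x h1 h2 ne hp hr.
by apply: (pl [fset p; q] [fset r; s]) => //; apply/on_edge2.
Qed.

Lemma plane_graph_edge S E p q : plane_graph S E -> [fset p; q] \in E ->
  [/\ p != q, p \in S & q \in S].
Proof.
case=> h _ /h []; rewrite cardfs2 => h2 /fsubsetP sub.
by split; [case: eqP h2|apply: sub; rewrite !inE eqxx|
  apply: sub; rewrite !inE eqxx orbT].
Qed.

Lemma edge_sub S p q : p != q -> p \in S -> q \in S ->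
  #|` [fset p; q]| = 2%N /\ [fset p; q] `<=` S.
Proof.
move=> pq pS qS; rewrite cardfs2 pq; split=> //.
by apply/fsubsetP => x; rewrite !inE => /orP[] /eqP ->.
Qed.

Lemma noncrossing_sym E1 E2 : noncrossing E1 E2 -> noncrossing E2 E1.
Proof.
by move=> h e1 e2 x h1 h2 ne o1 o2; case: (h e2 e1 x) => //; rewrite eq_sym.
Qed.

Lemma noncrossingUl E1 E2 E3 : noncrossing E1 E3 -> noncrossing E2 E3 ->
  noncrossing (E1 `|` E2) E3.
Proof. by move=> h1 h2 e1 e2 x; rewrite inE => /orP[]; [apply: h1|apply: h2]. Qed.

Lemma noncrossingU E1 E2 : noncrossing E1 E1 -> noncrossing E2 E2 ->
  noncrossing E1 E2 -> noncrossing (E1 `|` E2) (E1 `|` E2).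
Proof.
move=> h1 h2 h12; apply: noncrossingUl; apply: noncrossing_sym;
  apply: noncrossingUl => //.
exact: noncrossing_sym.
Qed.

(** The gluing criterion for plane graphs. A common point on a shared edge [f] is handled by
    comparing [e1] and [e2] with [f], each within its own graph; a common point that is a vertex of
    both graphs is an endpoint of every edge through it. *)
Lemma noncrossing_cut E1 E2 : noncrossing E1 E1 -> noncrossing E2 E2 ->
  (forall e1 e2 x, e1 \in E1 -> e2 \in E2 -> on_edge e1 x -> on_edge e2 x ->
    (exists f, [/\ f \in E1, f \in E2 & on_edge f x]) \/
    (exists v v', [fset x; v] \in E1 /\ [fset x; v'] \in E2)) ->
  noncrossing E1 E2.
Proof.
move=> n1 n2 cut e1 e2 x h1 h2 ne o1 o2.
case: (cut e1 e2 x h1 h2 o1 o2) => [[f [f1 f2 fx]]|[v [v' [hv hv']]]].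
  have [E1f|ne1] := eqVneq e1 f; first by subst f; apply: n2.
  have [E2f|ne2] := eqVneq e2 f; first by subst f; apply: n1.
  by split; [case: (n1 e1 f x)|case: (n2 e2 f x)].
have ov w : on_edge [fset x; w] x by apply/on_edge2/on_segmentl.
have xv w : x \in [fset x; w] by rewrite !inE eqxx.
split.
  have [->//|ne1] := eqVneq e1 [fset x; v].
  by case: (n1 e1 [fset x; v] x).
have [->//|ne2] := eqVneq e2 [fset x; v'].
by case: (n2 e2 [fset x; v'] x).
Qed.

Lemma noncrossing1 e : noncrossing [fset e] [fset e].
Proof.
by move=> e1 e2 x; rewrite !inE => /eqP -> /eqP ->; rewrite eqxx.
Qed.

(* Emptiness of the triangle [p b c] makes its angle at [p] an incident angle
   of every plane graph on [S] containing [E]. *)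
Definition wide_face S E p : Prop := exists b c,
  [/\ [fset p; b] \in E, [fset p; c] \in E, [fset b; c] \in E, wide p b c &
      forall s, s \in S -> ~~ in_tri p b c s].

Lemma wide_faceS S E F p : E `<=` F -> wide_face S E p -> wide_face S F p.
Proof. by move=> /fsubsetP EF [b [c [*]]]; exists b, c; split; auto. Qed.

(** Confining the edges to the closed triangle makes graphs of adjacent triangles meet only along
    the common side. *)
Definition tri_graph S a b c E : Prop :=
  [/\ plane_graph S E,
      [/\ [fset a; b] \in E, [fset b; c] \in E & [fset c; a] \in E],
      forall e x, e \in E -> on_edge e x -> in_ctri a b c x &
      forall p, p \in S -> in_tri a b c p -> wide_face S E p].

Lemma tri_graph_rot S a b c E : tri_graph S a b c E -> tri_graph S b c a E.
Proof.
case=> h1 [h2 h3 h4] h5 h6; split=> //; last by move=> p; rewrite -in_tri_rot; auto.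
by move=> e x; rewrite -in_ctri_rot; apply: h5.
Qed.

Lemma tri_graph_empty S a b c : a \in S -> b \in S -> c \in S ->
  0 < orient a b c -> (forall s, s \in S -> ~~ in_tri a b c s) ->
  tri_graph S a b c [fset [fset a; b]; [fset b; c]; [fset c; a]].
Proof.
move=> aS bS cS D0 em; have Dn : orient a b c != 0 by rewrite gt_eqF.
have [ab ac bc] := orient_neq Dn; have [ca cb cc] := in_ctri_verts D0.
split; [|by rewrite !inE !eqxx !orbT| |by move=> p /em /negbTE ->]; last first.
  move=> e x; rewrite !inE -orbA => /or3P[] /eqP -> /on_edge2;
    exact: on_segment_ctri.
apply/plane_graphE; split.
  move=> e; rewrite !inE -orbA => /or3P[] /eqP ->; apply: edge_sub => //.
  by rewrite eq_sym.
have share p q r : orient p q r != 0 ->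
    noncrossing [fset [fset p; q]] [fset [fset p; r]].
  move=> h e1 e2 x; rewrite !inE => /eqP -> /eqP -> _ /on_edge2 h1 /on_edge2 h2.
  by rewrite (on_segment_share h h1 h2) !inE !eqxx.
apply: noncrossingU; [apply: noncrossingU|exact: noncrossing1|].
- exact: noncrossing1.
- exact: noncrossing1.
- by rewrite fsetUC; apply: share; rewrite orient_swap oppr_eq0.
apply: noncrossingUl.
  by rewrite (fsetUC [fset c]); apply: share.
by rewrite (fsetUC [fset b]); apply: share; rewrite -orient_rot orient_swapr oppr_eq0.
Qed.

Lemma tri_graph_split S a b c p E1 E2 : general_position S ->
  [/\ a \in S, b \in S, c \in S & p \in S] -> in_tri a b c p -> wide p b c ->
  (forall s, s \in S -> ~~ in_tri p b c s) ->
  tri_graph S a b p E1 -> tri_graph S a p c E2 ->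
  tri_graph S a b c (E1 `|` E2 `|` [fset [fset b; c]]).
Proof.
move=> /gp_orient gp [aS bS cS pS] pin wp em.
case=> /plane_graphE[pl1 nc1] [ab1 bp1 pa1] in1 wf1.
case=> /plane_graphE[pl2 nc2] [ap2 pc2 ca2] in2 wf2.
case/and3P: (pin) => abp bcp cap.
have apc : 0 < orient a p c by rewrite -orient_rot.
have pbc : 0 < orient p b c by rewrite orient_rot.
have D0 : 0 < orient a b c by rewrite -(orient_sum a b c p); lra.
have [ca cb cc] := in_ctri_verts D0; have cp := in_triW pin.
have [_ neap nebp] := orient_neq (lt0r_neq0 abp).
have [nebc _ necp] := orient_neq (lt0r_neq0 bcp).
split.
- apply/plane_graphE; split.
    move=> e; rewrite !inE -orbA => /or3P[/pl1|/pl2|/eqP ->] //.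
    exact: edge_sub.
  have nc12 : noncrossing E1 E2.
    apply: noncrossing_cut => // e1 e2 x h1 h2 /(in1 _ _ h1) x1 /(in2 _ _ h2) x2.
    left; exists [fset a; p]; split => //; first by rewrite fsetUC.
    apply/on_edge2/(in_ctri_edge apc) => //.
    case/and3P: x1 => _ _; rewrite orient_swap oppr_ge0 => x1.
    by case/and3P: x2 => x2 _ _; apply/eqP; rewrite eq_le x1 x2.
  apply: noncrossingU; [exact: noncrossingU|exact: noncrossing1|].
  apply: noncrossingUl; apply: noncrossing_cut => //; try exact: noncrossing1.
    move=> e1 e2 x h1; rewrite inE => /eqP -> /(in1 _ _ h1) x1 /on_edge2 xbc.
    right; exists a, c.
    suff -> : x = b by rewrite inE eqxx fsetUC.
    case/and3P: (x1) => x11 x12 x13.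
    (* [orient b c] vanishes at [x] and is positive at [a] and [p], so both of these have weight
       zero and [x] is [b]. The case of [E2] and [c] is symmetric. *)
    have := orient_bary a b p b c x; rewrite orientpqp mulr0 addr0.
    case/on_segment_orient: xbc => t _ ->; rewrite orientpqp orientpqq.
    rewrite !mulr0 addr0 mulr0 -(orient_rot a) => /esym/eqP.
    rewrite paddr_eq0 ?mulr_ge0 ?(ltW D0) ?(ltW bcp) // !mulf_eq0.
    rewrite (gt_eqF D0) (gt_eqF bcp) !orbF => /andP[/eqP h2 /eqP h3].
    apply: (@on_segment_share _ b p a).
    + by rewrite -orient_rot gt_eqF.
    + by apply: (@in_ctri_edge _ b p a) => //; [rewrite -orient_rot|rewrite -in_ctri_rot].
    + exact/on_segment_sym/(in_ctri_edge abp).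
  move=> e1 e2 x h1; rewrite inE => /eqP -> /(in2 _ _ h1) x1 /on_edge2 xbc.
  right; exists a, b.
  suff -> : x = c by rewrite inE (fsetUC [fset b]) eqxx ca2.
  case/and3P: (x1) => x11 x12 x13.
  have := orient_bary a p c b c x; rewrite orientpqq mulr0 addr0.
  case/on_segment_orient: xbc => t _ ->; rewrite orientpqp orientpqq.
  rewrite !mulr0 addr0 mulr0 -(orient_rot a) => /esym/eqP.
  rewrite paddr_eq0 ?mulr_ge0 ?(ltW D0) ?(ltW bcp) // !mulf_eq0.
  rewrite (gt_eqF D0) (gt_eqF bcp) !orbF => /andP[/eqP h2 /eqP h3].
  apply: (@on_segment_share _ c a p).
  + by rewrite orient_rot gt_eqF.
  + by apply: (@in_ctri_edge _ c a p) => //; rewrite in_ctri_rot.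
  + apply/on_segment_sym/(@in_ctri_edge _ p c a) => //.
      by rewrite -orient_rot.
    by rewrite -in_ctri_rot.
- by rewrite !inE ab1 ca2 eqxx !orbT.
- move=> e x; rewrite !inE -orbA => /or3P[h|h|/eqP ->].
  + by move=> /(in1 _ _ h); apply: in_tri_ctri_sub.
  + by move=> /(in2 _ _ h); apply: in_tri_ctri_sub.
  + by move=> /on_edge2; apply: on_segment_ctri.
move=> q qS qin.
have [->|qp] := eqVneq q p.
  exists b, c; split=> //; rewrite !inE ?eqxx ?orbT //.
    by rewrite fsetUC bp1.
  by rewrite pc2 orbT.
case/and3P: (qin) => abq bcq caq.
have [_ neaq nebq] := orient_neq (lt0r_neq0 abq).
have [_ _ necq] := orient_neq (lt0r_neq0 bcq).
rewrite eq_sym in qp.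
(* A combination of [orient p a q], [orient p b q], [orient p c q] with positive weights vanishes,
   so their signs are not all equal. Every other sign pattern puts [q] into one of the three
   triangles at [p], and [em] excludes [p b c]. *)
have := orient_bary a b c q p p; rewrite orientpqq mulr0.
rewrite !(orient_rot q p) => /esym E0.
have : orient p a q != 0 by apply: gp => //; rewrite eq_sym.
have : orient p b q != 0 by apply: gp => //; rewrite eq_sym.
have : orient p c q != 0 by apply: gp => //; rewrite eq_sym.
have wide1 : in_tri a b p q -> wide_face S (E1 `|` E2 `|` [fset [fset b; c]]) q.
  move=> h; apply: wide_faceS (wf1 _ qS h).
  by rewrite -fsetUA fsubsetUl.
have wide2 : in_tri a p c q -> wide_face S (E1 `|` E2 `|` [fset [fset b; c]]) q.
  move=> h; apply: wide_faceS (wf2 _ qS h).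
  by rewrite fsetUAC fsubsetUr.
have := em q qS.
rewrite /in_tri bcq /= (orient_swap c p) oppr_gt0.
move: wide1 wide2; rewrite /in_tri abq caq /= andbT (orient_swap b p) (orient_swap a p) !oppr_gt0.
case: ltgtP => // c0; case: ltgtP => // b0; case: ltgtP => // a0 /=; auto;
  move=> *; exfalso; nra.
Qed.

Lemma exists_argmin (T : choiceType) (A : {fset T}) (g : T -> R) : A != fset0 ->
  exists2 x, x \in A & forall y, y \in A -> g x <= g y.
Proof.
case/fset0Pn=> x0 x0A.
case: (@arg_minP _ R A [` x0A] xpredT (fun i => g (val i))) => // i _ hi.
by exists (val i) => [|y yA]; [exact: valP|exact: (hi [` yA])].
Qed.

Lemma in_tri_sub a b c p s : in_tri a b c p -> in_tri a b p s -> in_tri a b c s.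
Proof.
case/and3P=> abp bcp cap /and3P[abs bps pas].
have D0 : 0 < orient a b c by rewrite -(orient_sum a b c p); lra.
apply/and3P; split=> //; rewrite -(pmulr_rgt0 _ abp) orient_bary.
  by rewrite orientpqp mulr0 addr0 addr_gt0 ?mulr_gt0 // -orient_rot.
by rewrite orientpqq mulr0 add0r addr_gt0 ?mulr_gt0 // orient_rot.
Qed.

Lemma exists_tri_graph S a b c : general_position S ->
  a \in S -> b \in S -> c \in S -> 0 < orient a b c -> exists E, tri_graph S a b c E.
Proof.
move=> gp.
pose ins a b c := [fset s in S | in_tri a b c s].
have [n] := ubnP #|` ins a b c|; elim: n => // n IH in a b c *.
move=> hn aS bS cS D0.
have [E0|/fset0Pn[p0]] := eqVneq (ins a b c) fset0.
  eexists; apply: tri_graph_empty => // s sS; apply/negP => hs.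
  by have := in_fset0 s; rewrite -E0 !inE sS hs.
rewrite !inE => /andP[p0S p0in].
have insS u v w p : p \in S -> in_tri u v w p -> (#|` ins u v w| < n.+1)%N ->
    (#|` ins u v p| < n)%N.
  move=> pS pin; rewrite ltnS; apply: leq_trans; apply: fproper_ltn_card.
  rewrite fproperE; apply/andP; split.
    by apply/fsubsetP => s; rewrite !inE => /andP[-> /(in_tri_sub pin)].
  by apply/fsubsetPn; exists p; rewrite !inE pS // /in_tri orientpqq ltxx andbF.
have ins_rot u v w : ins u v w = ins v w u.
  by apply/fsetP => s; rewrite !inE in_tri_rot.
(* The given [p0] only ensures that there is a candidate; the point [p] chosen below may be a
   different one. The cases of the other two sides follow by rotation. *)
have step u v w : (#|` ins u v w| < n.+1)%N -> u \in S -> v \in S -> w \in S ->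
    0 < orient u v w -> in_tri u v w p0 -> wide p0 v w ->
    exists E, tri_graph S u v w E.
  move=> {aS bS cS D0 p0in} {}hn uS vS wS D0 p0in w0.
  have : [fset s in S | in_tri u v w s && wide s v w] != fset0.
    by apply/fset0Pn; exists p0; rewrite !inE p0S p0in.
  move=> /(exists_argmin (fun s => orient v w s))[p].
  rewrite !inE => /and3P[pS pin wp] minp.
  case/and3P: (pin) => uvp vwp wup.
  (* A point inside [p v w] would again see [v w] widely and lie closer to it than [p]. *)
  have em s : s \in S -> ~~ in_tri p v w s.
    move=> sS; apply/negP => hs; have ws := wide_inner wp hs.
    have sin : in_tri u v w s.
      by rewrite in_tri_rot; apply: (@in_tri_sub v w u p); rewrite -in_tri_rot.
    have := minp s; rewrite !inE sS sin ws => /(_ isT).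
    case/and3P: (hs) => pvs vws wps.
    have := orient_sum p v w s; rewrite (orient_rot p v w); lra.
  have [E1 tE1] : exists E, tri_graph S u v p E by apply: IH => //; exact: insS hn.
  have [E2 tE2] : exists E, tri_graph S u p w E.
    apply: IH => //; last by rewrite -orient_rot.
    by rewrite -ins_rot; apply: (insS _ _ v) => //; [rewrite in_tri_rot|rewrite ins_rot].
  by eexists; apply: tri_graph_split tE1 tE2.
case/or3P: (wide_exists p0in) => wp; first exact: (step a b c).
- have hn' : (#|` ins b c a| < n.+1)%N by rewrite -ins_rot.
  have D' : 0 < orient b c a by rewrite -orient_rot.
  have p0in' : in_tri b c a p0 by rewrite -in_tri_rot.
  have [E tE] := step b c a hn' bS cS aS D' p0in' wp.
  by exists E; do 2 apply: tri_graph_rot.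
- have hn' : (#|` ins c a b| < n.+1)%N by rewrite ins_rot.
  have D' : 0 < orient c a b by rewrite orient_rot.
  have p0in' : in_tri c a b p0 by rewrite in_tri_rot.
  have [E tE] := step c a b hn' cS aS bS D' p0in' wp.
  by exists E; apply: tri_graph_rot.
Qed.

End PlaneGraphs.

(** * Convex hulls and fans *)

Section Fan.
Context {R : realType}.
Local Notation point := (R * R)%type.
Implicit Types (a b c o p q r s u v w x : point) (S : {fset point}).
Implicit Types (E F : {fset {fset point}}).

(** Hull edges are directed counterclockwise; having an outgoing one is how a hull vertex is
    expressed below. *)
Definition hull_edge S u v : Prop := [/\ u \in S, v \in S, u != v &
  forall w, w \in S -> w != u -> w != v -> 0 < orient u v w].

(** The difference formula for cotangents or tangents, denominators cleared: it turns an extremal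
    ratio of [dot_at] and [orient] into an extremal direction at [p]. *)
Lemma orient_dot p q s t : orient p s t * dot_at p q q =
  dot_at p q s * orient p q t - orient p q s * dot_at p q t.
Proof. by rewrite /orient /dot_at; ring. Qed.

Lemma sqdist_gt0 p q : p != q -> 0 < dot_at p q q.
Proof.
move=> pq; rewrite lt_def addr_ge0 -?expr2 ?sqr_ge0 // andbT.
apply: contraNneq pq => /eqP; rewrite /dot_at -!expr2 paddr_eq0 ?sqr_ge0 //.
rewrite !sqrf_eq0 !subr_eq0 => /andP[/eqP h1 /eqP h2].
by rewrite [p]surjective_pairing [q]surjective_pairing h1 h2.
Qed.

(* A point at maximal distance from the origin will do. *)
Lemma exists_hull_vertex S : general_position S -> S != fset0 ->
  exists2 o, o \in S & S = [fset o] \/ exists u, hull_edge S o u.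
Proof.
move=> /gp_orient gp.
move=> /(exists_argmin (fun s : point => - (s.1 ^+ 2 + s.2 ^+ 2)))[o oS omax].
exists o => //; have [/eqP|S'n] := eqVneq (S `\ o) fset0.
  by rewrite fsetD_eq0 fsubset1 => /orP[/eqP|/eqP S0]; [left|rewrite S0 in oS].
right; pose z : point := (0, 0).
have d0 s : s \in S -> s != o -> 0 < dot_at o z s.
  move=> sS so; have := omax s sS; rewrite lerN2.
  have := sqdist_gt0 so; rewrite /dot_at /=; lra.
(* Seen from [o], all other points are within a right angle of the direction to the origin; the
   least tangent gives the most clockwise one. *)
have [u] := exists_argmin (fun s => orient o z s / dot_at o z s) S'n.
rewrite !inE => /andP[uo uS] umin; exists u; split=> //; first by rewrite eq_sym.
move=> w wS wo wu; rewrite lt_def.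
have -> /= : orient o u w != 0 by apply: gp => //; rewrite eq_sym.
have dz : 0 < dot_at o z z.
  apply: sqdist_gt0; apply: contraTneq (d0 u uS uo) => oz.
  by rewrite /dot_at -oz !subrr !mul0r addr0 ltxx.
rewrite -(pmulr_lge0 _ dz) orient_dot subr_ge0 /=.
have := umin w; rewrite !inE wo wS => /(_ isT).
rewrite ler_pdivrMr ?d0 // mulrAC ler_pdivlMr ?d0 //; lra.
Qed.

(** For [N] the neighbours of [p], the most counterclockwise one is [q]; sweeping on from [q] to any
    other takes more than a half-turn, across the outside of the hull. *)
Lemma hull_edge_extreme S N p u : general_position S -> hull_edge S p u ->
  N `<=` S -> p \notin N -> N != fset0 ->
  exists2 q, q \in N & forall s, s \in N -> s != q -> orient p q s < 0.
Proof.
move=> /gp_orient gp [pS uS pu hull] /fsubsetP NS pN Nn.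
have np s : s \in N -> p != s by move=> sN; apply: contraNneq pN => ->.
have [N'0|N'n] := eqVneq (N `\ u) fset0.
  case/fset0Pn: Nn => q qN; exists q => // s sN sq.
  have eu t : t \in N -> t = u.
    by move=> tN; apply/eqP; have := in_fset0 t; rewrite -N'0 !inE tN andbT => /negbFE.
  by move: sq; rewrite (eu s sN) (eu q qN) eqxx.
(* The least cotangent belongs to the largest angle from [u]; [u] itself is left out because
   [orient p u u] is zero. *)
have [q] := exists_argmin (fun s => dot_at p u s / orient p u s) N'n.
rewrite !inE => /andP[qu qN] qmin; exists q => // s sN sq.
have pos t : t \in N -> t != u -> 0 < orient p u t.
  by move=> tN tu; apply: hull => //; [exact: NS|rewrite eq_sym np].
have [->|su] := eqVneq s u; first by rewrite orient_swapr oppr_lt0 pos.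
rewrite lt_def eq_sym.
have -> /= : orient p q s != 0 
  by apply: gp => //; [exact: NS|exact: NS|exact: np|exact: np|rewrite eq_sym].
rewrite -(pmulr_lle0 _ (sqdist_gt0 pu)) orient_dot subr_le0.
have := qmin s; rewrite !inE su sN => /(_ isT).
rewrite ler_pdivrMr ?pos // mulrAC ler_pdivlMr ?pos //; lra.
Qed.

(** If no point is to the right of [po], this is a hull edge. Otherwise let [v] be the most
    clockwise point there, as seen from [p]. A point [r] to the left of [po] and to the right of
    [pv] encloses [p] together with [o] and [v]; if there is none, [pv] is a hull edge. *)
Lemma hull_vertex_or_in_tri S o p : general_position S -> o \in S -> p \in S ->
  p != o -> (exists u, hull_edge S p u) \/
            (exists u v, [/\ u \in S, v \in S & in_tri o u v p]).
Proof.
move=> /gp_orient gp oS pS po.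
pose L := [fset s in S | orient p o s < 0].
have ne s : orient p o s != 0 -> s != p /\ s != o.
  by case/orient_neq=> _ ? ?; split; rewrite eq_sym.
have [L0|Ln] := eqVneq L fset0.
  left; exists o; split=> // w wS wp wo.
  have : w \notin L by rewrite L0.
  have : orient p o w != 0 by apply: gp => //; rewrite eq_sym.
  by rewrite !inE wS /=; case: ltgtP.
have [v] := exists_argmin (fun s => - (dot_at p o s / orient p o s)) Ln.
rewrite !inE => /andP[vS ov] vmin.
have [vp vo] := ne v (ltr0_neq0 ov).
have vL s : s \in S -> orient p o s < 0 -> s != v -> 0 < orient p v s.
  move=> sS os sv; have [sp so] := ne s (ltr0_neq0 os).
  rewrite lt_def; have -> /= : orient p v s != 0 by apply: gp => //; rewrite eq_sym.
  rewrite -(pmulr_lge0 _ (sqdist_gt0 po)) orient_dot subr_ge0 /=.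
  have := vmin s; rewrite !inE sS os => /(_ isT); rewrite lerN2.
  rewrite ler_ndivrMr // mulrAC ler_ndivrMr //; lra.
pose Q := [fset s in S | (0 < orient p o s) && (orient p v s < 0)].
have [Q0|/fset0Pn[r]] := eqVneq Q fset0; last first.
  rewrite !inE => /and3P[rS or vr]; right; exists r, v; split=> //.
  apply/and3P; split; first by rewrite -orient_rot.
    by rewrite orient_rot orient_rot orient_swapr oppr_gt0 -orient_rot orient_rot.
  by rewrite -orient_rot orient_swapr oppr_gt0.
left; exists v; split=> //; first by rewrite eq_sym.
move=> w wS wp wv.
have [->|wo] := eqVneq w o; first by rewrite orient_swapr oppr_gt0.
have : orient p o w != 0 by apply: gp => //; rewrite eq_sym.
have : orient p v w != 0 by apply: gp => //; rewrite eq_sym.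
have : w \notin Q by rewrite Q0.
rewrite !inE wS /=.
by case: (ltgtP (orient p o w) 0) => // h; [move=> _ _ _; exact: vL|case: ltgtP].
Qed.

(* Among the pairs [u], [v] whose triangle with apex [o] contains [p], one with
   maximal barycentric coordinate of [o] at [p] has its segment farthest along
   the ray from [o] through [p]. *)
Lemma hull_vertex_or_fan S o p : general_position S -> o \in S -> p \in S ->
  p != o -> (exists u, hull_edge S p u) \/
            (exists u v, hull_edge S u v /\ in_tri o u v p).
Proof.
move=> gp oS pS po; case: (hull_vertex_or_in_tri gp oS pS po) => [|h]; first by left.
move/gp_orient: gp => gp.
right; pose P := [fset uv in S `*` S | in_tri o uv.1 uv.2 p].
have : P != fset0.
  by case: h => u [v [uS vS h]]; apply/fset0Pn; exists (u, v); rewrite !inE /= uS vS.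
move=> /(exists_argmin (fun uv => - (orient uv.1 uv.2 p / orient o uv.1 uv.2))).
case=> -[r v]; rewrite !inE /= => /andP[/andP[rS vS] pin] pmin.
exists r, v; split=> //; case/and3P: (pin) => orp rvp vop.
have D0 : 0 < orient o r v by rewrite -(orient_sum o r v p); lra.
have [neor neov nerv] := orient_neq (lt0r_neq0 D0).
split=> // w wS wr wv; rewrite lt_def.
have -> /= : orient r v w != 0 by apply: gp => //; rewrite eq_sym.
rewrite leNgt; apply/negP => rvw.
have rvo : 0 < orient r v o by rewrite -orient_rot.
have wo : w != o by apply: contraTneq rvw => ->; rewrite -leNgt ltW.
have wp : w != p by apply: contraTneq rvw => ->; rewrite -leNgt ltW.
have : orient o p w != 0 by apply: gp => //; rewrite eq_sym.
have I1 : orient o r v * orient o p w =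
    orient v o p * orient o r w - orient o r p * orient v o w.
  by rewrite /orient; ring.
have sumw := orient_sum o r v w.
(* A point [w] beyond [r v] replaces [r] or [v], according to its side of the ray from [o] through
   [p]. The new triangle still contains [p], and by [I2] and [J] the coordinate of [o] grows,
   against [pmin]. *)
case: ltgtP => // opw _.
- have opw' : orient o r v * orient o p w < 0 by rewrite pmulr_rlt0.
  have D' : 0 < orient v o w.
    by rewrite ltNge; apply/negP => h'; nra.
  have I2 : orient w v p * orient o r v - orient r v p * orient v o w =
     - (orient v o p * orient r v w) by rewrite /orient; ring.
  have J : orient v o p * orient r v w < 0 by rewrite pmulr_rlt0.
  have wvp : 0 < orient w v p.
    rewrite -(pmulr_lgt0 _ D0); have : 0 < orient r v p * orient v o w by rewrite mulr_gt0.
    lra.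
  have := pmin (w, v); rewrite !inE /= wS vS /in_tri wvp vop.
  rewrite (orient_swapr o w p) oppr_gt0 opw => /(_ isT).
  rewrite lerN2 -(orient_rot v o w) ler_pdivrMr // mulrAC ler_pdivlMr //; lra.
- have opw' : 0 < orient o r v * orient o p w by rewrite pmulr_rgt0.
  have D' : 0 < orient o r w.
    by rewrite ltNge; apply/negP => h'; nra.
  have I2 : orient r w p * orient o r v - orient r v p * orient o r w =
     - (orient o r p * orient r v w) by rewrite /orient; ring.
  have J : orient o r p * orient r v w < 0 by rewrite pmulr_rlt0.
  have rwp : 0 < orient r w p.
    rewrite -(pmulr_lgt0 _ D0); have : 0 < orient r v p * orient o r w by rewrite mulr_gt0.
    lra.
  have := pmin (r, w); rewrite !inE /= wS rS /in_tri rwp orp.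
  rewrite (orient_rot w o p) opw => /(_ isT).
  rewrite lerN2 ler_pdivrMr // mulrAC ler_pdivlMr //; lra.
Qed.

(** The line [u' v'] has all of [S] on one side and [o] strictly so; a point inside [o u v] has
    positive weight at [o], so it cannot lie on this line as [u'] does. *)
Lemma hull_edge_not_in_tri S o u v u' v' : hull_edge S u v -> hull_edge S u' v' ->
  o \in S -> o != u' -> o != v' -> ~~ in_tri o u v u'.
Proof.
move=> [uS vS _ _] [u'S v'S nuv' hull'] oS ou' ov'; apply/negP => hin.
case/and3P: (hin) => h1 h2 h3.
have o0 := hull' o oS ou' ov'.
have ge0 w : w \in S -> 0 <= orient u' v' w.
  move=> wS; have [->|wu] := eqVneq w u'; first by rewrite orientpqp.
  have [->|wv] := eqVneq w v'; first by rewrite orientpqq.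
  exact: ltW (hull' _ _ _ _).
have := orient_bary o u v u' v' u'; rewrite orientpqp mulr0.
have : 0 < orient u v u' * orient u' v' o by rewrite mulr_gt0.
have : 0 <= orient v o u' * orient u' v' u by rewrite mulr_ge0 ?ge0 ?ltW.
have : 0 <= orient o u u' * orient u' v' v by rewrite mulr_ge0 ?ge0 ?ltW.
lra.
Qed.

Lemma hull_edge_inj S u v u' v' : hull_edge S u v -> hull_edge S u' v' ->
  u = u' \/ v = v' -> u = u' /\ v = v'.
Proof.
move=> [uS vS nuv hull] [u'S v'S nuv' hull'] [E|E]; subst; split=> //.
  apply: contra_eq (erefl true) => vv'.
  have := hull v' v'S; have := hull' v vS.
  rewrite ![v == u']eq_sym ![v' == u']eq_sym nuv nuv' vv' [v' == v]eq_sym vv'.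
  move=> /(_ isT isT) h1 /(_ isT isT) h2.
  by have := orient_swapr u' v v'; lra.
apply: contra_eq (erefl true) => uu'.
have := hull u' u'S; have := hull' u uS.
rewrite nuv nuv' uu' [u' == u]eq_sym uu'.
move=> /(_ isT isT) h1 /(_ isT isT) h2.
have := orient_swap u v' u'; have := orient_rot u u' v'; have := orient_rot u' v' u.
have := orient_swapr u u' v'; lra.
Qed.

(** The line through [o] and [u'] separates the two sectors: [orient o u'] is nonnegative on the
    second triangle and nonpositive on the first. Equality removes the weight of [u], which leaves
    [x] on both [ov] and [ou']. *)
Lemma fan_meet o u v u' v' x : 0 < orient o u v -> 0 < orient o u' v' ->
  0 < orient o u u' -> v = u' \/ 0 < orient o v u' ->
  in_ctri o u v x -> in_ctri o u' v' x ->
  x = o \/ v = u' /\ on_segment o v x.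
Proof.
move=> D0 D0' uu' vu' x1 x2; case/and3P: (x1) => ux uvx vx.
case/and3P: (x2) => u'x _ _.
have := orient_bary o u v o u' x; rewrite orientpqp mulr0 add0r => E1.
have nvu' : orient o u' v <= 0.
  by case: vu' => [->|h]; rewrite ?orientpqq // orient_swapr oppr_le0 ltW.
have nuu' : orient o u' u < 0 by rewrite orient_swapr oppr_lt0.
have h1 : 0 <= orient o u v * orient o u' x by rewrite mulr_ge0 // ltW.
have h2 : orient v o x * orient o u' u <= 0 by rewrite mulr_ge0_le0 // ltW.
have h3 : orient o u x * orient o u' v <= 0 by rewrite mulr_ge0_le0.
have /eqP : orient v o x * orient o u' u = 0 by lra.
rewrite mulf_eq0 (lt_eqF nuu') orbF => /eqP vx0.
have /eqP : orient o u v * orient o u' x = 0 by lra.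
rewrite mulf_eq0 (gt_eqF D0) /= => /eqP u'x0.
have sv : on_segment o v x.
  apply/on_segment_sym/(@in_ctri_edge _ v o u) => //; first by rewrite orient_rot.
  by rewrite in_ctri_rot.
case: vu' => [E|h]; [by right|left].
apply: (on_segment_share _ sv (in_ctri_edge D0' x2 u'x0)).
by rewrite gt_eqF.
Qed.

Lemma exists_open_plane_graph S : general_position S -> S != fset0 ->
  exists2 E, plane_graph S E & forall p, p \in S ->
    [\/ S = [fset p], exists u, hull_edge S p u | wide_face S E p].
Proof.
move=> gp Sn; have [o oS oext] := exists_hull_vertex gp Sn.
pose P (uv : point * point) := [/\ hull_edge S uv.1 uv.2, o != uv.1 & o != uv.2].
have pos uv : P uv -> 0 < orient o uv.1 uv.2.
  by case=> -[_ _ _ h] o1 o2; rewrite orient_rot h.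
(* Choice asks for a graph at every pair; pairs outside [P] get the empty one and are skipped in the
   union [E]. *)
have /choice[F hF] : forall uv, exists E, P uv -> tri_graph S o uv.1 uv.2 E.
  move=> uv; case: (EM (P uv)) => [Puv|]; last by exists fset0.
  have [[uS vS _ _] _ _] := Puv.
  by have [E tE] := exists_tri_graph gp oS uS vS (pos _ Puv); exists E.
pose E := \bigcup_(uv <- S `*` S | `[< P uv >]) F uv.
have inEP e : e \in E -> exists2 uv, P uv & e \in F uv.
  by case/bigfcupP=> uv /andP[_ /asboolP Puv] euv; exists uv.
have FE uv : P uv -> F uv `<=` E.
  move=> Puv; apply/fsubsetP => e euv; apply/bigfcupP; exists uv => //.
  by have [[uS vS _ _] _ _] := Puv; rewrite !inE uS vS; apply/asboolP.
exists E.
  apply/plane_graphE; split.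
    move=> e /inEP[uv /hF[/plane_graphE[h _] _ _ _]]; exact: h.
  (* If [uv'.1] comes after [uv.1] around [o], it also comes after [uv.2] or equals it; otherwise
     this hull vertex would lie inside the triangle of [uv]. *)
  have key uv uv' x : P uv -> P uv' -> 0 < orient o uv.1 uv'.1 ->
      in_ctri o uv.1 uv.2 x -> in_ctri o uv'.1 uv'.2 x ->
      x = o \/ uv.2 = uv'.1 /\ on_segment o uv.2 x.
    move=> Puv Puv' uu' x1 x2; apply: fan_meet x1 x2 => //; try exact: pos.
    have [h h1 h2] := Puv; have [h' h1' h2'] := Puv'.
    have nin := hull_edge_not_in_tri h h' oS h1' h2'.
    have [E1|ne] := eqVneq uv.2 uv'.1; [by left|right].
    have [_ vS _ _] := h; have [u'S _ _ _] := h'.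
    have : orient o uv.2 uv'.1 != 0 by apply: (gp_orient S).1.
    rewrite lt_def => -> /=; rewrite leNgt; apply: contra nin => neg.
    apply/and3P; split=> //; last by rewrite orient_swap oppr_gt0.
    case: h => _ _ _; apply=> //; last by rewrite eq_sym.
    by have [_ _] := orient_neq (lt0r_neq0 uu'); rewrite eq_sym.
  move=> e1 e2 x /inEP[uv Puv e1uv] /inEP[uv' Puv' e2uv'].
  move: e1 e2 x e1uv e2uv'; change (noncrossing (F uv) (F uv')).
  have [/plane_graphE[_ n1] [ou uv1 vo] in1 _] := hF _ Puv.
  have [/plane_graphE[_ n2] [ou' uv1' vo'] in2 _] := hF _ Puv'.
  have [<-//|neq] := eqVneq uv uv'.
  apply: noncrossing_cut => // e1 e2 x h1 h2 /(in1 _ _ h1) x1 /(in2 _ _ h2) x2.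
  have [[hu o1 o2] [hu' o1' o2']] := (Puv, Puv').
  have nu : uv.1 != uv'.1.
    apply: contraNneq neq => E1.
    have [_ E2] := hull_edge_inj hu hu' (or_introl E1).
    by rewrite [uv]surjective_pairing [uv']surjective_pairing E1 E2.
  have : orient o uv.1 uv'.1 != 0.
    by case: hu => ? _ _ _; case: hu' => ? _ _ _; apply: (gp_orient S).1.
  case: ltgtP => // uu' _.
    have [|->|[E1 on]] := key uv' uv x Puv' Puv _ x2 x1.
    - by rewrite orient_swapr oppr_gt0.
    - by right; exists uv.1, uv'.1.
    - left; exists [fset o; uv.1]; split => //; last by apply/on_edge2; rewrite -E1.
      by rewrite -E1 fsetUC.
  have [->|[E1 on]] := key uv uv' x Puv Puv' uu' x1 x2.
    by right; exists uv.1, uv'.1.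
  left; exists [fset o; uv'.1]; split => //; last by apply/on_edge2; rewrite -E1.
  by rewrite -E1 fsetUC.
move=> p pS; have [->|po] := eqVneq p o.
  by case: oext => [|h]; [exact: Or31|exact: Or32].
have [|[u [v [huv pin]]]] := hull_vertex_or_fan gp oS pS po; first exact: Or32.
apply: Or33.
have Puv : P (u, v).
  case/and3P: (pin) => h1 h2 h3.
  have := orient_sum o u v p => E1; have D0 : 0 < orient o u v by lra.
  by have [h4 h5 _] := orient_neq (lt0r_neq0 D0).
have [_ _ _ wf] := hF _ Puv.
exact: wide_faceS (FE _ Puv) (wf p pS pin).
Qed.

End Fan.

(** * Openness of maximal extensions *)

Section Openness.
Context {R : realType}.
Local Notation point := (R * R)%type.
Implicit Types (b c p q r s u v x : point) (S : {fset point}).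
Implicit Types (E T : {fset {fset point}}).

(** Edges are subsets of [S], so the size of its power set bounds how often a plane graph can be
    enlarged. *)
Lemma exists_triangulation S E : plane_graph S E ->
  exists2 T, triangulation S T & E `<=` T.
Proof.
have [n] := ubnP (#|` fpowerset S| - #|` E|)%N; elim: n E => // n IH E hn pE.
case: (EM (triangulation S E)) => [|nE]; first by exists E.
have [F pF [EF FE]] : exists2 F, plane_graph S F & E `<=` F /\ F <> E.
  have /existsNP[F hF] : ~ forall F, plane_graph S F -> E `<=` F -> F = E.
    by move=> h; apply: nE.
  by have /not_implyP[pF /not_implyP[EF FE]] := hF; exists F.
have EFp : E `<` F by rewrite fproperEneq EF andbT; apply/eqP => h; apply: FE.
have FS : (#|` F| <= #|` fpowerset S|)%N.
  apply: fsubset_leq_card; apply/fsubsetP => e /pF.1[_].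
  by rewrite fpowersetE.
have [|T tT FT] := IH F _ pF; last by exists T => //; apply: fsubset_trans FT.
have := fproper_ltn_card EFp; move: hn FS; lia.
Qed.

Lemma in_neighbours S E p s :
  (s \in neighbours S E p) = (s \in S) && ([fset p; s] \in E).
Proof. by rewrite !inE. Qed.

Lemma neighboursP S E p s : plane_graph S E -> s \in neighbours S E p ->
  [/\ s \in S, p != s & [fset p; s] \in E].
Proof.
move=> pE; rewrite in_neighbours => /andP[sS ps].
by have [h _ _] := plane_graph_edge pE ps.
Qed.

(** The incident angle starting at [q] ends at the neighbour with the least [angle_at p q], so
    bounding the angles to all other neighbours bounds it. *)
Lemma le_vertex_openness S E p q : q \in neighbours S E p ->
  (forall s, s \in neighbours S E p -> s != q -> 2 * pi / 3 <= angle_at p q s) ->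
  2 * pi / 3 <= vertex_openness S E p.
Proof.
move=> qN hq; have pi0 := pi_gt0 R.
rewrite /vertex_openness; case: leqP => [_|N2]; first by lra.
have Nn : neighbours S E p `\ q != fset0.
  by rewrite -cardfs_gt0; have := cardfsD1 q (neighbours S E p); rewrite qN; lia.
have [r] := exists_argmin (angle_at p q) Nn.
rewrite in_fsetD1 => /andP[rq rN] rmin.
apply: (@bigmax_sup_seq _ _ _ _ _ q) => //.
apply: (@bigmax_sup_seq _ _ _ _ _ r) => //; last exact: hq.
rewrite /consecutive qN rN eq_sym rq /=; apply/allP => s sN; apply/implyP => sq.
by apply: rmin; rewrite in_fsetD1 sq.
Qed.

Lemma hull_vertex_openness S E p u : general_position S -> plane_graph S E ->
  hull_edge S p u -> 2 * pi / 3 <= vertex_openness S E p.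
Proof.
move=> gp pE hpu; have pi0 := pi_gt0 R; have [pS _ _ _] := hpu.
have [N0|Nn] := eqVneq (neighbours S E p) fset0.
  by rewrite /vertex_openness N0 cardfs0 leq0n; lra.
have NS : neighbours S E p `<=` S.
  by apply/fsubsetP => s /(neighboursP pE)[].
have pN : p \notin neighbours S E p.
  by apply/negP => /(neighboursP pE)[_]; rewrite eqxx.
have [q qN hq] := hull_edge_extreme gp hpu NS pN Nn.
apply: (le_vertex_openness qN) => s sN sq; have := hq s sN sq => h.
by apply: le_2pi3_angle_at; [rewrite lt_eqF|rewrite /wide_or_reflex h].
Qed.

Lemma segments_cross p b c s : 0 < orient p b c -> 0 < orient p b s -> 0 < orient p s c ->
  orient b c s < 0 -> exists2 x, on_segment b c x & on_segment p s x.
Proof.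
move=> D0 bs sc bcs; set W := orient p b s + orient p s c.
have W0 : 0 < W by rewrite /W; lra.
have Wn : W != 0 by rewrite gt_eqF.
have E1 : W = orient p b c - orient b c s by rewrite /W /orient; ring.
(* The diagonals of the quadrilateral [p b s c], of doubled area [W], meet here; the parameters on
   [bc] and [ps] are ratios of areas. *)
exists (((orient p s c * b.1 + orient p b s * c.1) / W),
        ((orient p s c * b.2 + orient p b s * c.2) / W)).
  exists (orient p b s / W); split.
    rewrite divr_ge0 ?(ltW bs) ?(ltW W0) //= ler_pdivrMr // mul1r /W; lra.
  have -> : 1 - orient p b s / W = orient p s c / W.
    by rewrite -{1}(divff Wn) {1}/W; field.
  by congr pair; field.
exists (orient p b c / W); split.
  rewrite divr_ge0 ?(ltW W0) ?(ltW D0) //= ler_pdivrMr // mul1r; lra.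
have -> : 1 - orient p b c / W = - orient b c s / W.
  by rewrite -{1}(divff Wn) {1}E1; field.
congr pair; apply: (mulfI Wn).
  transitivity (orient p s c * b.1 + orient p b s * c.1); first by field.
  transitivity (- orient b c s * p.1 + orient p b c * s.1); last by field.
  by rewrite /orient; ring.
transitivity (orient p s c * b.2 + orient p b s * c.2); first by field.
transitivity (- orient b c s * p.2 + orient p b c * s.2); last by field.
by rewrite /orient; ring.
Qed.

(** An edge [ps] of [T] inside the angle from [b] to [c] would end in the empty triangle or cross
    the edge [bc]. So the incident angle starting at [b] reaches at least to [c]. *)
Lemma wide_face_openness S E T p : general_position S -> plane_graph S T ->
  E `<=` T -> p \in S -> wide_face S E p -> 2 * pi / 3 <= vertex_openness S T p.
Proof.
move=> /gp_orient gp pT /fsubsetP ET pS [b [c [/ET pb /ET pc /ET bc w em]]].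
have [npb _ bS] := plane_graph_edge pT pb.
have [npc _ cS] := plane_graph_edge pT pc.
have [nbc _ _] := plane_graph_edge pT bc.
apply: (@le_vertex_openness _ _ _ b); first by rewrite !inE bS.
move=> s /(neighboursP pT)[sS nps ps] sb.
have bs0 : orient p b s != 0 by apply: gp => //; rewrite eq_sym.
apply: le_2pi3_angle_at => //; rewrite /wide_or_reflex.
move: bs0; case: (ltgtP (orient p b s) 0) => // bs _ /=.
have [->|sc] := eqVneq s c; first by case/andP: w.
have : orient p c s != 0 by apply: gp => //; rewrite eq_sym.
case: (ltgtP (orient p c s) 0) => // cs _; last exact: wide_beyond w bs cs.
have : orient b c s != 0 by apply: gp => //; rewrite eq_sym.
have := em s sS; rewrite /in_tri bs (orient_swap c p) oppr_gt0 cs andbT.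
case: (ltgtP (orient b c s) 0) => // bcs _ _.
have sc0 : 0 < orient p s c by rewrite orient_swapr oppr_gt0.
have D0 : 0 < orient p b c by case/andP: w.
have [x xbc xps] := segments_cross D0 bs sc0 bcs.
have ne : [fset p; s] != [fset b; c].
  by apply/eqP => /fset2_eq[] [E1 _]; [move: npb|move: npc]; rewrite E1 eqxx.
have [_ pl] := pT; have [] := pl p s b c x ps bc ne xps xbc.
rewrite !inE => /orP[] /eqP -> /orP[] /eqP E1.
- by rewrite E1 eqxx in npb.
- by rewrite E1 eqxx in npc.
- by rewrite E1 eqxx in sb.
- by rewrite E1 eqxx in sc.
Qed.

Lemma exists_open_triangulation S : S != fset0 -> general_position S ->
  exists T, triangulation S T /\ phi_open S T (2 * pi / 3).
Proof.
move=> Sn gp; have pi0 := pi_gt0 R.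
have [E pE hE] := exists_open_plane_graph gp Sn.
have [T tT ET] := exists_triangulation pE; have [pT _] := tT.
exists T; split=> //; rewrite /phi_open /openness big_seq.
apply: le_bigmin => [|p pS]; first by lra.
case: (hE p pS) => [S1|[u hpu]|wf].
- rewrite /vertex_openness (_ : neighbours S T p = fset0) ?cardfs0 ?leq0n; first by lra.
  apply/eqP/fset0Pn => -[s /(neighboursP pT)[]].
  by rewrite S1 inE => /eqP ->; rewrite eqxx.
- exact: hull_vertex_openness hpu.
exact: wide_face_openness wf.
Qed.

End Openness.

(** * The equilateral triangle with its center *)

Section LowerBound.
Context {R : realType}.
Local Notation point := (R * R)%type.
Implicit Types (b c p q r s u v x : point) (T : {fset {fset point}}).

Let k : R := Num.sqrt 3.
Let k_gt0 : 0 < k. Proof. by rewrite sqrtr_gt0; lra. Qed.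
Let k2 : k * k = 3. Proof. by rewrite -expr2 sqr_sqrtr //; lra. Qed.

Definition star : {fset point} := [fset (0, 0); (2, 0); (-1, k); (-1, - k)].

Definition complete_graph : {fset {fset point}} :=
  [fset e in fpowerset star | #|` e| == 2%N].

Lemma starP p : reflect [\/ p = (0, 0), p = (2, 0), p = (-1, k) | p = (-1, - k)]
  (p \in star).
Proof.
rewrite !inE -!orbA; apply: (iffP or4P) => -[/eqP|/eqP|/eqP|/eqP] h;
  by [constructor 1|constructor 2|constructor 3|constructor 4].
Qed.

Lemma star_orient p q r : p \in star -> q \in star -> r \in star ->
  p != q -> p != r -> q != r -> orient p q r != 0.
Proof.
have k0 := k_gt0.
case/starP=> -> /starP[] -> /starP[] -> ; rewrite ?eqxx // => _ _ _;
  by apply/eqP; rewrite /orient /= => h; lra.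
Qed.

(** Of two disjoint edges, one is a side of the triangle, and its line has the opposite vertex and
    the center on the same side. *)
Lemma star_disjoint p q r s : p \in star -> q \in star -> r \in star -> s \in star ->
  p != q -> p != r -> p != s -> q != r -> q != s -> r != s ->
  (0 < orient p q r * orient p q s) || (0 < orient r s p * orient r s q).
Proof.
have h2 := k2.
case/starP=> -> /starP[] ->; rewrite ?eqxx // => /starP[] ->; rewrite ?eqxx ?andbF //;
move=> /starP[] ->; rewrite ?eqxx // => _ _ _ _ _ _; apply/orP;
  rewrite /orient /=; first [by left; nra | by right; nra].
Qed.

Lemma disjoint_segments p q r s x : 0 < orient p q r * orient p q s ->
  on_segment p q x -> ~ on_segment r s x.
Proof.
move=> h /on_segment_orient[t _ ht] /on_segment_orient[t' /andP[t0 t1] ht'].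
have := ht' p q; rewrite ht orientpqp orientpqq !mulr0 addr0.
move: (orient p q r) (orient p q s) h => y z h E.
(* Multiplying the vanishing convex combination of [y] and [z] by [y + z] leaves squares and the
   positive product [y * z]. *)
have : 0 = y * z + (1 - t') * y ^+ 2 + t' * z ^+ 2.
  by transitivity (((1 - t') * y + t' * z) * (y + z)); [rewrite -E mul0r|ring].
have : 0 <= (1 - t') * y ^+ 2 by rewrite mulr_ge0 ?sqr_ge0 ?subr_ge0.
have : 0 <= t' * z ^+ 2 by rewrite mulr_ge0 ?sqr_ge0.
lra.
Qed.

Lemma in_complete_graph (e : {fset point}) :
  (e \in complete_graph) = (e `<=` star) && (#|` e| == 2%N).
Proof. by rewrite !inE fpowersetE. Qed.

Lemma complete_graphP p q : reflect [/\ p != q, p \in star & q \in star]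
  ([fset p; q] \in complete_graph).
Proof.
rewrite in_complete_graph cardfs2; apply: (iffP andP).
  case=> /fsubsetP sub; rewrite eqSS eqb1 => pq.
  by split=> //; apply: sub; rewrite !inE eqxx ?orbT.
by case=> pq pS qS; have [h1 h2] := edge_sub pq pS qS; rewrite pq.
Qed.

Lemma complete_graph_plane : plane_graph star complete_graph.
Proof.
split; first by move=> e; rewrite in_complete_graph => /andP[-> /eqP ->].
have share p q s x : p \in star -> q \in star -> s \in star -> p != q -> p != s ->
    q != s -> on_segment p q x -> on_segment p s x ->
    x \in [fset p; q] /\ x \in [fset p; s].
  move=> pS qS sS pq ps qs h1 h2.
  by rewrite (on_segment_share (star_orient pS qS sS pq ps qs) h1 h2) !inE eqxx.
move=> p q r s x /complete_graphP[pq pS qS] /complete_graphP[rs rS sS] ne xpq xrs.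
have [E|pr] := eqVneq p r.
  subst r; apply: share => //; by apply: contraNneq ne => ->.
have [E|ps] := eqVneq p s.
  subst s; rewrite (fsetUC [fset r]); apply: share => //.
    by apply: contraNneq ne => ->; rewrite fsetUC.
  exact: on_segment_sym.
have [E|qr] := eqVneq q r.
  subst r; rewrite (fsetUC [fset p]); apply: share => //; first by rewrite eq_sym.
  exact: on_segment_sym.
have [E|qs] := eqVneq q s.
  subst s; rewrite (fsetUC [fset p]) (fsetUC [fset r]).
  by apply: share; rewrite // 1?eq_sym //; apply: on_segment_sym.
case/orP: (star_disjoint pS qS rS sS pq pr ps qr qs rs) => h.
  by case: (disjoint_segments h xpq xrs).
by case: (disjoint_segments h xrs xpq).
Qed.

Lemma star_triangulation T : triangulation star T -> T = complete_graph.
Proof.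
case=> -[sub pl] maxT; apply/esym/maxT; first exact: complete_graph_plane.
by apply/fsubsetP => e /sub[e2 eS]; rewrite in_complete_graph eS e2.
Qed.

Lemma star_openness T : triangulation star T -> openness star T <= 2 * pi / 3.
Proof.
move=> /star_triangulation ->; have pi0 := pi_gt0 R; have k0 := k_gt0.
have h2 := k2; pose o : point := (0, 0).
have oS : o \in star by apply/starP; constructor 1.
apply: (@bigmin_inf_seq _ _ _ _ _ o) => //.
rewrite /vertex_openness.
have nb s : s \in star -> s != o -> s \in neighbours star complete_graph o.
  by move=> sS so; rewrite in_neighbours sS; apply/complete_graphP; rewrite eq_sym.
have a : (2, 0) \in neighbours star complete_graph o.
  apply: nb; first by apply/starP; constructor 2.
  by apply/eqP => -[]; lra.
have b : (-1, k) \in neighbours star complete_graph o.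
  apply: nb; first by apply/starP; constructor 3.
  by apply/eqP => -[]; lra.
have c : (-1, - k) \in neighbours star complete_graph o.
  apply: nb; first by apply/starP; constructor 4.
  by apply/eqP => -[]; lra.
have ab : (2, 0) != (-1, k) :> point by apply/eqP => -[]; lra.
have ac : (2, 0) != (-1, - k) :> point by apply/eqP => -[]; lra.
have bc : (-1, k) != (-1, - k) :> point by apply/eqP => -[]; lra.
(* The center has more than one neighbour, so the default openness [2 * pi] does not occur. *)
case: leqP => [N1|_].
  have := fsubset_leq_card (_ : [fset (2, 0); (-1, k)] `<=` neighbours star complete_graph o).
  rewrite cardfs2 ab => /(_ _)/leq_trans/(_ N1) h; suff : false by [].
  by apply: h; apply/fsubsetP => x; rewrite !in_fset2 => /orP[] /eqP ->.
apply: bigmax_le => [|q _]; first by lra.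
apply: bigmax_le => [|r]; first by lra.
case/and4P=> qN _ _ /allP hr.
(* A consecutive angle from [q] is at most the angle to any other neighbour, and one of these lies
   exactly 120 degrees counterclockwise of [q]. *)
suff [s sN [sq <-]] : exists2 s, s \in neighbours star complete_graph o &
    s != q /\ angle_at o q s = 2 * pi / 3.
  exact: implyP (hr s sN) sq.
have [/starP qS oq _] := neighboursP complete_graph_plane qN.
case: qS oq => -> => [|_|_|_]; first by rewrite eqxx.
- exists (-1, k) => //; split; first by rewrite eq_sym.
  by apply: angle_at_eq_2pi3; rewrite /orient /dot_at /=; lra.
- exists (-1, -k) => //; split; first by rewrite eq_sym.
  by apply: angle_at_eq_2pi3; rewrite /orient /dot_at /=; lra.
- exists (2, 0) => //.
  by split => //; apply: angle_at_eq_2pi3; rewrite /orient /dot_at /=; lra.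
Qed.

End LowerBound.

Theorem theorem1 (R : realType) :
  (forall S : {fset R * R}, S != fset0 -> general_position S ->
     exists T : {fset {fset R * R}},
       triangulation S T /\ phi_open S T (2 * pi / 3)) /\
  (forall eps : R, 0 < eps ->
     exists S : {fset R * R}, [/\ S != fset0, general_position S &
       forall T : {fset {fset R * R}}, triangulation S T ->
         openness S T < 2 * pi / 3 + eps]).
Proof.
split=> [S Sn gp|eps eps0]; first exact: exists_open_triangulation.
exists star; split.
- by apply/fset0Pn; exists (0, 0); apply/starP; constructor 1.
- by apply/gp_orient => p q r; apply: star_orient.
- by move=> T /star_openness h; apply: le_lt_trans h _; rewrite ltrDl.
Qed.
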